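(* Let $\mu_1,\mu_2\in\mathcal{M}^1_{\mathrm{fm},\pi}(\Gamma)$, and let $\rho_1,\rho_2$ be the correlation measures on $(\Gamma_0,\mathcal{B}(\Gamma_0))$ corresponding to $\mu_1,\mu_2$, respectively. Then $\rho:=\rho_1\ast\rho_2$ is the correlation measure of $\mu:=\mu_1\ast\mu_2$.
   Context: Setting. $X$ is a connected oriented non-compact Riemannian $C^\infty$-manifold with Borel $\sigma$-algebra $\mathcal{B}(X)$; $\mathcal{B}_{\mathrm c}(X)$ is the class of Borel sets with compact closure. $m$ is a non-atomic Radon measure on $X$ ($m(\Lambda)<\infty$ for $\Lambda\in\mathcal{B}_{\mathrm c}(X)$, $m(\{x\})=0$ for all $x$), and there is an increasing sequence $\Lambda_n\in\mathcal{B}_{\mathrm c}(X)$ with $\bigcup_n\Lambda_n=X$. Finite configurations. $\Gamma_0=\bigsqcup_{n\ge0}\Gamma^{(n)}$, where $\Gamma^{(n)}$ is the set of $n$-point subsets of $X$ (identified with $\{(x_1,\dots,x_n)\in X^n: x_k\ne x_l \text{ for } k\ne l\}/S_n$, with the induced quotient topology, $\Gamma_0$ carrying the disjoint union topology), $\Gamma^{(0)}=\{\emptyset\}$, with Borel $\sigma$-algebra $\mathcal{B}(\Gamma_0)$. For $\Lambda\in\mathcal{B}_{\mathrm c}(X)$, $\Gamma^{(n)}_\Lambda$ is the set of $n$-point subsets of $\Lambda$. A set $B\in\mathcal{B}(\Gamma_0)$ is bounded, written $B\in\mathcal{B}_{\mathrm b}(\Gamma_0)$, if $B\subset\bigsqcup_{n=0}^N\Gamma_\Lambda^{(n)}$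 for some $\Lambda\in\mathcal{B}_{\mathrm c}(X)$, $N\in\mathbb{N}$. For $z>0$ the Lebesgue–Poisson measure is $\lambda_z=\sum_{n\ge0}\frac{z^n}{n!}m^{(n)}$, where $m^{(n)}$ is the image of $m^{\otimes n}$ on $\Gamma^{(n)}$ ($m^{(0)}(\{\emptyset\})=1$). Locally finite configurations. $\Gamma$ is the set of all $\gamma\subset X$ with $|\gamma\cap\Lambda|<\infty$ for all $\Lambda\in\mathcal{B}_{\mathrm c}(X)$; $\gamma_\Lambda:=\gamma\cap\Lambda$; $\mathcal{B}(\Gamma)$ is the smallest $\sigma$-algebra making all maps $\gamma\mapsto|\gamma_\Lambda|$, $\Lambda\in\mathcal{B}_{\mathrm c}(X)$, measurable. $\Gamma_\Lambda$ is the set of (finite) configurations contained in $\Lambda$, $\mathcal{B}(\Gamma_\Lambda)$ is its $\sigma$-algebra as a subset of $\Gamma_0$, and $p_\Lambda:\Gamma\to\Gamma_\Lambda$, $p_\Lambda(\gamma)=\gamma_\Lambda$. $\mathcal{M}^1_{\mathrm{fm}}(\Gamma)$ is the class of probability measures $\mu$ on $(\Gamma,\mathcal{B}(\Gamma))$ with $\int_\Gamma|\gamma_\Lambda|^n\,d\mu(\gamma)<\infty$ for all $\Lambda\in\mathcal{B}_{\mathrm c}(X)$, $n\in\mathbb{N}_0$. $\mathcal{M}^1_{\mathrm{fm},\pi}(\Gamma)$ is the class of $\mu\in\mathcal{M}^1_{\mathrm{fm}}(\Gamma)$ that are locally absolutely continuous w.r.t. a Poisson measure, i.e. for every $\Lambda\in\mathcal{B}_{\mathrm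 c}(X)$ the projection $\mu^\Lambda:=\mu\circ p_\Lambda^{-1}$ is absolutely continuous w.r.t. $\pi_z^\Lambda:=e^{-zm(\Lambda)}\lambda_z$ on $\Gamma_\Lambda$ (this does not depend on $z>0$). Correlation measure. For $\mu\in\mathcal{M}^1_{\mathrm{fm}}(\Gamma)$ its correlation measure $\rho_\mu$ on $(\Gamma_0,\mathcal{B}(\Gamma_0))$ is given by $\rho_\mu(A)=\int_\Gamma (K\mathbf{1}_A)(\gamma)\,d\mu(\gamma)$, $A\in\mathcal{B}_{\mathrm b}(\Gamma_0)$, where $(KG)(\gamma)=\sum_{\eta\subset\gamma,\ |\eta|<\infty}G(\eta)$. It is locally finite (finite on bounded sets). Convolutions. For probability measures $\mu_1,\mu_2$ on $\Gamma$, $\mu=\mu_1\ast\mu_2$ is the probability measure on $\Gamma$ with $\int_\Gamma F\,d\mu=\int_\Gamma\int_\Gamma F(\gamma^+\cup\gamma^-)\,d\mu_1(\gamma^+)\,d\mu_2(\gamma^-)$ for every measurable $F:\Gamma\to\mathbb{R}$ such that $(\gamma^+,\gamma^-)\mapsto F(\gamma^+\cup\gamma^-)$ is $\mu_1\otimes\mu_2$-integrable. For measures $\rho_1,\rho_2$ on $\Gamma_0$, $\rho=\rho_1\ast\rho_2$ is the measure on $\Gamma_0$ with $\int_{\Gamma_0}G\,d\rho=\int_{\Gamma_0}\int_{\Gamma_0}G(\eta_1\cup\eta_2)\,d\rho_1(\eta_1)\,d\rho_2(\eta_2)$ for every measurable $G:\Gamma_0\to\mathbb{R}$ for which the right-hand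 side is finite. *)

(* Defs.v *)
From HB Require Import structures.
From mathcomp Require Import all_boot all_order all_algebra.
From mathcomp Require Import finmap.
From mathcomp Require Import all_classical all_reals all_analysis.

Set Implicit Arguments.
Unset Strict Implicit.
Unset Printing Implicit Defensive.

Import Order.TTheory GRing.Theory Num.Theory.
Import numFieldNormedType.Exports.

Local Open Scope classical_set_scope.
Local Open Scope ring_scope.

Section smooth.
Context {R : realType} {d : nat} {V : normedModType R}.

Definition iter_partial (f : 'rV[R]_d -> V) (s : seq 'I_d) : 'rV[R]_d -> V :=
  foldr (fun i g => fun x => 'D_(delta_mx 0 i) g x) f s.

(* f is C^oo on the open set U: all iterated partial derivatives exist and are
   continuous at the points of U. *)
Definition smooth_on (U : set 'rV[R]_d) (f : 'rV[R]_d -> V) : Prop :=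
  forall (s : seq 'I_d) (x : 'rV[R]_d), U x ->
    {for x, continuous (iter_partial f s)} /\
    forall i, derivable (iter_partial f s) x (delta_mx 0 i).

End smooth.

Record chart (R : realType) (d : nat) (X : topologicalType) := Chart {
  chart_dom : set X ;
  chart_map : X -> 'rV[R]_d ;
  chart_inv : 'rV[R]_d -> X ;
  chart_dom_open : open chart_dom ;
  chart_cod_open : open (chart_map @` chart_dom) ;
  chart_mapK : forall x, chart_dom x -> chart_inv (chart_map x) = x ;
  chart_map_continuous : {within chart_dom, continuous chart_map} ;
  chart_inv_continuous :
    {within chart_map @` chart_dom, continuous chart_inv}
}.

Definition transition (R : realType) (d : nat) (X : topologicalType)
    (c c' : chart R d X) : 'rV[R]_d -> 'rV[R]_d :=
  fun v => chart_map c' (chart_inv c v).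

Definition overlap (R : realType) (d : nat) (X : topologicalType)
    (c c' : chart R d X) : set 'rV[R]_d :=
  chart_map c @` (chart_dom c `&` chart_dom c').

(* The Riemannian metric is given by its Gram matrices in the charts. As
   jacobians act on row vectors on the right, v *m 'J f x is the image of v
   under the differential of f at x. *)
Record oriented_riemannian_manifold (R : realType) (d : nat)
    (X : topologicalType) := OrientedRiemannianManifold {
  mfd_hausdorff : hausdorff_space X ;
  mfd_second_countable : @second_countable X ;
  mfd_index : Type ;
  mfd_chart : mfd_index -> chart R d X ;
  mfd_cover : forall x : X, exists i, chart_dom (mfd_chart i) x ;
  mfd_smooth : forall i j,
    smooth_on (overlap (mfd_chart i) (mfd_chart j))
              (transition (mfd_chart i) (mfd_chart j)) ;
  mfd_oriented : forall i j v, overlap (mfd_chart i) (mfd_chart j) v ->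
    0 < \det (jacobian (transition (mfd_chart i) (mfd_chart j)) v) ;
  mfd_metric : mfd_index -> 'rV[R]_d -> 'M[R]_d ;
  mfd_metric_smooth : forall i,
    smooth_on (chart_map (mfd_chart i) @` chart_dom (mfd_chart i))
              (mfd_metric i) ;
  mfd_metric_sym : forall i v,
    (chart_map (mfd_chart i) @` chart_dom (mfd_chart i)) v ->
    (mfd_metric i v)^T = mfd_metric i v ;
  mfd_metric_pos : forall i v,
    (chart_map (mfd_chart i) @` chart_dom (mfd_chart i)) v ->
    forall w : 'rV[R]_d, w != 0 -> 0 < (w *m mfd_metric i v *m w^T) 0 0 ;
  mfd_metric_compat : forall i j v, overlap (mfd_chart i) (mfd_chart j) v ->
    let f := transition (mfd_chart i) (mfd_chart j) in
    mfd_metric i v =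
      jacobian f v *m mfd_metric j (f v) *m (jacobian f v)^T
}.

Definition borel (X : ptopologicalType) := g_sigma_algebraType (@open X).

Definition bounded_borel (X : ptopologicalType) (L : set X) : Prop :=
  measurable (L : set (borel X)) /\ compact (closure L).

Definition radon (R : realType) (X : ptopologicalType)
    (m : {measure set (borel X) -> \bar R}) : Prop :=
  forall L : set X, bounded_borel L -> (m L < +oo)%E.

Definition non_atomic (R : realType) (X : ptopologicalType)
    (m : {measure set (borel X) -> \bar R}) : Prop :=
  forall x : X, m [set x] = 0%E.

Section finite_configurations.
Context {X : ptopologicalType}.

Definition fset_of_tuple (n : nat) (t : n.-tuple X) : {fset X} :=
  [fset x in (t : seq X)]%fset.

(* The topology of Gamma_0: for each n, the preimage of U under
   (x_1, ..., x_n) |-> {x_1, ..., x_n}, a set of n-tuples of distinct points,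
   is open for the subspace topology induced by X^n. *)
Definition finconf_open (U : set {fset X}) : Prop :=
  forall n : nat, exists2 V : set (prod_topology (fun _ : 'I_n => X)),
    open V &
    forall t : n.-tuple X, uniq t ->
      (U (fset_of_tuple t) <-> V (fun i => tnth t i)).

Definition finconf_in (L : set X) : set {fset X} :=
  [set eta : {fset X} | [set` eta] `<=` L].

End finite_configurations.

(* (Gamma_0, B(Gamma_0)) *)
Definition finconf (X : ptopologicalType) :=
  g_sigma_algebraType (@finconf_open X).

Definition bounded_finconf (X : ptopologicalType) (A : set (finconf X)) : Prop :=
  measurable A /\
  exists L : set X, exists N : nat, bounded_borel L /\
    forall eta : {fset X}, A eta -> finconf_in L eta /\ (#|` eta| <= N)%N.

Section lebesgue_poisson.
Context {R : realType} {X : ptopologicalType}.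
Variable m : {measure set (borel X) -> \bar R}.
Local Open Scope ereal_scope.

(* m^{(x) n} on n-tuples, by the section formula defining product_measure1 *)
Fixpoint power_measure (n : nat) : set (n.-tuple (borel X)) -> \bar R :=
  match n with
  | 0 => fun A => \d_([tuple] : 0.-tuple (borel X)) A
  | n'.+1 => fun A =>
      \int[m]_x power_measure
                  [set t : n'.-tuple (borel X) | A [tuple of x :: t]]
  end.

Definition finconf_measure (n : nat) (A : set (finconf X)) : \bar R :=
  power_measure [set t : n.-tuple (borel X) | uniq t /\ A (fset_of_tuple t)].

Definition lebesgue_poisson (z : R) (A : set (finconf X)) : \bar R :=
  \sum_(0 <= n <oo) (z ^+ n / n`!%:R)%:E * finconf_measure n A.

(* pi_z^L, extended by 0 from Gamma_L to Gamma_0 *)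
Definition poisson_in (z : R) (L : set X) (A : set (finconf X)) : \bar R :=
  (expR (- (z * fine (m L))))%:E * lebesgue_poisson z (A `&` finconf_in L).

End lebesgue_poisson.

Section configurations.
Context {X : ptopologicalType}.

Definition locally_finite (g : set X) : Prop :=
  forall L : set X, bounded_borel L -> finite_set (g `&` L).

Record conf0 := Conf { conf_set :> set X ; conf_lf : locally_finite conf_set }.

Lemma locally_finite0 : locally_finite set0.
Proof. by move=> L _; rewrite set0I. Qed.

Lemma locally_finiteU (g h : set X) :
  locally_finite g -> locally_finite h -> locally_finite (g `|` h).
Proof.
by move=> lg lh L bL; rewrite setIUl finite_setU; split; [exact: lg|exact: lh].
Qed.

HB.instance Definition _ := gen_eqMixin conf0.
HB.instance Definition _ := gen_choiceMixin conf0.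
HB.instance Definition _ := isPointed.Build conf0 (Conf locally_finite0).

Definition confU (g h : conf0) : conf0 :=
  Conf (locally_finiteU (@conf_lf g) (@conf_lf h)).

(* p_L; meaningful when L is a bounded Borel set, as then g `&` L is finite *)
Definition conf_proj (L : set X) (g : conf0) : {fset X} := fset_set (g `&` L).

Definition conf_count (L : set X) (g : conf0) : nat := #|` conf_proj L g|.

Definition conf_cylinders : set (set conf0) :=
  [set C | exists L : set X, exists B : set nat,
    bounded_borel L /\ C = conf_count L @^-1` B].

End configurations.
Arguments conf0 : clear implicits.

(* (Gamma, B(Gamma)) *)
Definition conf (X : ptopologicalType) :=
  g_sigma_algebraType (@conf_cylinders X).

Section measures_on_configurations.
Context {R : realType} {X : ptopologicalType}.
Local Open Scope ereal_scope.

Definition finite_moments (mu : probability (conf X) R) : Prop :=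
  forall (L : set X) (n : nat), bounded_borel L ->
    \int[mu]_g ((conf_count L g ^ n)%:R)%:E < +oo.

Definition locally_abs_continuous (m : {measure set (borel X) -> \bar R})
    (mu : probability (conf X) R) : Prop :=
  exists2 z : R, (0 < z)%R & forall L : set X, bounded_borel L ->
    (pushforward mu (conf_proj L : conf X -> finconf X) : set _ -> \bar R)
      `<< poisson_in m z L.

Definition M1_fm_pi (m : {measure set (borel X) -> \bar R})
    (mu : probability (conf X) R) : Prop :=
  finite_moments mu /\ locally_abs_continuous m mu.

(* the K-transform, for nonnegative G *)
Definition K_transform (G : finconf X -> \bar R) (g : conf X) : \bar R :=
  \esum_(eta in (finconf_in (g : conf0 X) : set {fset X})) G eta.

Definition is_correlation_measure (mu : probability (conf X) R)
    (rho : {measure set (finconf X) -> \bar R}) : Prop :=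
  finite_moments mu /\
  forall A : set (finconf X), bounded_finconf A ->
    rho A = \int[mu]_g K_transform (fun eta => (\1_A eta)%:E) g.

Definition is_conf_convolution (mu1 mu2 mu : probability (conf X) R) : Prop :=
  forall F : conf X -> R, measurable_fun setT F ->
    (mu1 \x mu2).-integrable setT
      (fun p : conf X * conf X => (F (confU p.1 p.2))%:E) ->
    \int[mu]_g (F g)%:E =
    \int[mu2]_g2 \int[mu1]_g1 (F (confU g1 g2))%:E.

(* Finiteness of the double integral of a signed G is understood as that of
   the double integral of its absolute value. *)
Definition is_finconf_convolution
    (rho1 rho2 rho : {measure set (finconf X) -> \bar R}) : Prop :=
  forall G : finconf X -> R, measurable_fun setT G ->
    \int[rho2]_eta2 \int[rho1]_eta1 `|G (eta1 `|` eta2)%fset|%:E < +oo ->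
    \int[rho]_eta (G eta)%:E =
    \int[rho2]_eta2 \int[rho1]_eta1 (G (eta1 `|` eta2)%fset)%:E.

End measures_on_configurations.

(* Main.v *)
Require Import Defs.
From HB Require Import structures.
From mathcomp Require Import all_boot all_order all_algebra.
From mathcomp Require Import finmap.
From mathcomp Require Import all_classical all_reals all_analysis.
From mathcomp Require Import measurable_realfun zify.

(** By second countability and the Hausdorff property, the points of a finite
    set are eventually separated by their membership vectors ("codes") in the
    first [k] basic open sets.  Hence membership in an open set of finite
    configurations is the pointwise limit of functions of the finite set of
    codes, which makes unions, traces on a bounded set and the counting of
    sub-configurations measurable.  The identity itself is Campbell's formula
    [int h drho = int (K h) dmu], applied to [rho1] and then to [rho2], together
    with the splitting of the subsets of [g1 U g2] into pairs of subsets of [g1]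
    and [g2].  This splitting needs [g1] and [g2] to be disjoint, which holds
    almost surely because local absolute continuity and non-atomicity give
    [mu1 {g | x in g} = 0] for every point [x]. *)

Set Implicit Arguments.
Unset Strict Implicit.
Unset Printing Implicit Defensive.

Import Order.TTheory GRing.Theory Num.Theory.

Local Open Scope classical_set_scope.
Local Open Scope ring_scope.

(** * Counting the subsets of a finite set that belong to a given family *)

Section counting_subsets.
Context {X : choiceType}.
Implicit Types (A : set {fset X}) (E P Q : {fset X}).

(** This is the K-transform of the indicator of [A] at the finite configuration [E], kept as a
    natural number so that its measurability can be treated discretely. *)
Definition count_sub (A : set {fset X}) (E : {fset X}) : nat :=
  (\sum_(eta <- fpowerset E) `[< A eta >])%N.

Lemma count_subE A E : count_sub A E = count (fun eta => `[< A eta >]) (fpowerset E).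
Proof.
by rewrite /count_sub -sum1_count [RHS]big_mkcond; apply: eq_bigr => eta _; case: asboolP.
Qed.

Lemma count_sub_set0 E : count_sub set0 E = 0%N.
Proof. by rewrite /count_sub big1 // => eta _; rewrite asboolF. Qed.

(* A subset with at most [N] elements is the range of a partial function
   on [N] points. *)
Lemma leq_count_sub A E N : (forall eta, A eta -> (#|` eta| <= N)%N) ->
  (count_sub A E <= #|` E|.+1 ^ N)%N.
Proof.
move=> AN; rewrite count_subE -size_filter.
pose F (f : {ffun 'I_N -> option E}) : {fset X} :=
  [fset x in E | [exists i, f i == insub x]]%fset.
have <- : size [seq F f | f <- enum {ffun 'I_N -> option E}] = (#|` E|.+1 ^ N)%N.
  by rewrite size_map -cardE card_ffun card_option card_ord cardfE.
apply: uniq_leq_size; first by rewrite filter_uniq // fset_uniq.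
move=> eta; rewrite mem_filter fpowersetE => /andP[/asboolP/AN etaN /fsubsetP etaE].
apply/mapP.
exists [ffun i : 'I_N => nth None [seq insub x : option E | x <- enum_fset eta] i].
  by rewrite mem_enum.
apply/fsetP => x; rewrite !inE /=; apply/idP/andP => [xe|[xE /existsP[i]]].
  split; first exact: etaE.
  have xi : (index x eta < N)%N by apply: leq_trans etaN; rewrite index_mem.
  apply/existsP; exists (Ordinal xi); rewrite ffunE /=.
  by rewrite (nth_map x) ?index_mem // nth_index.
rewrite ffunE insubT => /eqP.
have [isz|isz] := ltnP i (size (enum_fset eta)); last by rewrite nth_default // size_map.
rewrite (nth_map x) // => h.
have xnE : nth x (enum_fset eta) i \in E by apply: etaE; exact: mem_nth.
by move: h; rewrite insubT => -[<-]; exact: mem_nth.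
Qed.

(** Union maps pairs of a subset of [P] and a subset of [Q] onto the subsets of the union.
    Disjointness makes this a bijection, and the count is then grouped by the part in [Q]. This is
    the combinatorial core of the convolution identity. *)
Lemma count_subU A P Q : [disjoint P & Q]%fset ->
  count_sub A (P `|` Q)%fset =
  (\sum_(eta2 <- fpowerset Q) count_sub [set eta1 | A (eta1 `|` eta2)%fset] P)%N.
Proof.
move=> dPQ; rewrite /count_sub.
rewrite (perm_big [seq (eta1 `|` eta2)%fset | eta2 <- fpowerset Q, eta1 <- fpowerset P]) /=.
  by rewrite big_allpairs_dep.
have PQ0 : (P `&` Q)%fset = fset0 by apply/eqP.
(* The traces on [P] and [Q] recover the pair from its union, which yields injectivity. *)
have restr eta1 eta2 : (eta1 `<=` P)%fset -> (eta2 `<=` Q)%fset ->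
    ((eta1 `|` eta2) `&` P)%fset = eta1 /\ ((eta1 `|` eta2) `&` Q)%fset = eta2.
  move=> /fsubsetP e1P /fsubsetP e2Q.
  have PQ x : x \in P -> x \in Q -> False.
    by move=> xP xQ; have := in_fset0 x; rewrite -PQ0 inE xP xQ.
  split; apply/fsetP => x; rewrite !inE.
    apply/andP/idP => [[/orP[//|/e2Q xQ xP]]|xe]; first by case: (PQ x).
    by rewrite xe e1P.
  apply/andP/idP => [[/orP[/e1P xP xQ|//]]|xe]; first by case: (PQ x).
  by rewrite xe orbT e2Q.
apply: uniq_perm; first exact: fset_uniq.
  apply: allpairs_uniq; [exact: fset_uniq|exact: fset_uniq|].
  move=> _ _ /allpairsP[[a b] /= [+ + ->]] /allpairsP[[a' b'] /= [+ + ->]] /=.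
  rewrite !fpowersetE => aQ bP a'Q b'P ab.
  have [b_ a_] := restr _ _ bP aQ; have [b'_ a'_] := restr _ _ b'P a'Q.
  by congr (_, _); [rewrite -[LHS]a_ ab|rewrite -[LHS]b_ ab].
move=> eta; rewrite fpowersetE; apply/idP/allpairsP => [ePQ|[[a b] /= [+ + ->]]].
  exists (eta `&` Q, eta `&` P)%fset; rewrite !fpowersetE !fsubsetIr; split => //=.
  by rewrite -fsetIUr; apply/esym/fsetIidPl.
by rewrite !fpowersetE => aQ bP; exact: fsetUSS.
Qed.

End counting_subsets.

(** * Measurability with respect to the discrete sigma-algebra *)

Section discretely_measurable.
Context {d : measure_display} {W : measurableType d}.

(** Every subset of the target counts as measurable. This suits codes and counts, whose targets are
    finite or countable, and it asks for no structure on [T]. *)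
Definition dmeas {T : Type} (f : W -> T) :=
  forall P : set T, measurable (f @^-1` P).

Lemma dmeas_comp {T1 T2 : Type} (g : T1 -> T2) (f : W -> T1) :
  dmeas f -> dmeas (g \o f).
Proof. by move=> mf P; rewrite comp_preimage; exact: mf. Qed.

(** The sequences [F k w] are eventually equal to their limit, so [f w] lies in [P] exactly when
    [F k w] does for all large [k]: the preimage is a lower limit of preimages. *)
Lemma dmeas_lim {T : Type} (F : nat -> W -> T) (f : W -> T) :
  (forall k, dmeas (F k)) ->
  (forall w, \forall k \near \oo, F k w = f w) -> dmeas f.
Proof.
move=> mF Ff P.
rewrite (_ : f @^-1` P = \bigcup_n \bigcap_(k in [set k | (n <= k)%N]) (F k @^-1` P)).
  by apply: bigcup_measurable => n _; apply: bigcap_measurableType => k _; exact: mF.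
apply/seteqP; split => [w Pw|w [n _ nP]].
  by have [n _ nF] := Ff w; exists n => // k /= nk; rewrite nF.
have [k _ kF] := Ff w.
have := nP (maxn n k) (leq_maxl _ _).
by rewrite /preimage /= kF //= leq_maxr.
Qed.

Lemma dmeas_countable {T : countType} (f : W -> T) :
  (forall t, measurable (f @^-1` [set t])) -> dmeas f.
Proof.
move=> mf P; rewrite (_ : f @^-1` P = \bigcup_(t in P) (f @^-1` [set t])).
  rewrite bigcup_mkcond; apply: countable_bigcupT_measurable => [|t].
    exact: countableP.
  by case: ifP.
apply/seteqP; split => [w Pw|w [t Pt /= ft]]; first by exists (f w).
by rewrite /preimage /= ft.
Qed.

Lemma dmeas_pair {T1 T2 : countType} (f : W -> T1) (g : W -> T2) :
  dmeas f -> dmeas g -> dmeas (fun w => (f w, g w)).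
Proof.
move=> mf mg; apply: dmeas_countable => -[a b].
rewrite (_ : _ @^-1` _ = f @^-1` [set a] `&` g @^-1` [set b]).
  by apply: measurableI; [exact: mf|exact: mg].
by apply/seteqP; split => w /= [] -> ->.
Qed.

Lemma dmeas_op {T1 T2 : countType} {T : Type} (op : T1 -> T2 -> T)
    (f : W -> T1) (g : W -> T2) :
  dmeas f -> dmeas g -> dmeas (fun w => op (f w) (g w)).
Proof.
move=> mf mg; exact: (dmeas_comp (fun p => op p.1 p.2) (dmeas_pair mf mg)).
Qed.

Lemma dmeas_cst {T : Type} (t : T) : dmeas (fun=> t).
Proof. by move=> P; rewrite preimage_cst; case: ifP. Qed.

Lemma dmeas_sum {I : Type} (s : seq I) (f : I -> W -> nat) :
  (forall i, dmeas (f i)) -> dmeas (fun w => \sum_(i <- s) f i w)%N.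
Proof.
move=> mf; elim: s => [|i s ih].
  by under eq_fun do rewrite big_nil; exact: dmeas_cst.
by under eq_fun do rewrite big_cons; apply: dmeas_op.
Qed.

Lemma dmeas_ffun {I : finType} {T : finType} (f : I -> W -> T) :
  (forall i, dmeas (f i)) -> dmeas (fun w => [ffun i => f i w]).
Proof.
move=> mf; apply: dmeas_countable => t.
rewrite (_ : _ @^-1` _ = \bigcap_(i in [set: I]) (f i @^-1` [set t i])).
  apply: fin_bigcap_measurable => // i _; exact: mf.
apply/seteqP; split => [w /= <- i _ /=|w wt /=]; first by rewrite ffunE.
by apply/ffunP => i; rewrite ffunE; exact: wt.
Qed.

Lemma dmeas_set {I : finType} (f : I -> W -> bool) :
  (forall i, dmeas (f i)) -> dmeas (fun w => [set i | f i w]%SET).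
Proof.
move=> mf; have := dmeas_comp (fun t : {ffun I -> bool} => [set i | t i]%SET) (dmeas_ffun mf).
congr dmeas; apply/funext => w; apply/setP => i.
by rewrite !inE ffunE.
Qed.

Lemma dmeas_nat (f : W -> nat) :
  (forall j, measurable [set w | (j <= f w)%N]) -> dmeas f.
Proof.
move=> mf; apply: dmeas_countable => j.
rewrite (_ : _ @^-1` _ = [set w | (j <= f w)%N] `\` [set w | (j.+1 <= f w)%N]).
  exact: measurableD.
apply/seteqP; split => [w /= <-|w /= [jf /negP]]; first by rewrite ltnn.
by rewrite -leqNgt => fj; apply/eqP; rewrite eqn_leq fj.
Qed.

Lemma dmeas_measurable_fun {d'} {T : measurableType d'} (f : W -> T) :
  dmeas f -> measurable_fun setT f.
Proof. by move=> mf _ P _; rewrite setTI; exact: mf. Qed.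

End discretely_measurable.

Lemma dmeas_measurable_comp {d d'} {W : measurableType d} {V : measurableType d'}
    {T : Type} (f : V -> T) (g : W -> V) :
  dmeas f -> measurable_fun setT g -> dmeas (f \o g).
Proof. by move=> mf mg P; have := mg measurableT _ (mf P); rewrite setTI. Qed.

Lemma prod_topology_cvg {X : topologicalType} {n : nat}
    (F : set_system (prod_topology (fun _ : 'I_n => X)))
    (f : prod_topology (fun _ : 'I_n => X)) : Filter F ->
  (forall i (W : set X), open W -> W (f i) -> F [set g | W (g i)]) ->
  F --> f.
Proof.
move=> FF HF; apply/cvg_sup => i A.
rewrite (@nbhsE (initial_topology (proj i))) => -[_ [[W oW <-] Wfi]].
by move/filterS; apply; exact: HF.
Qed.

(** * Codes of points and finite sets with respect to a countable base *)

Section basis_codes.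
Context {X : ptopologicalType} {B : nat -> set X}.
Hypothesis Bopen : forall n, open (B n).
Hypothesis Bbasis : forall (x : X) (U : set X), open U -> U x ->
  exists n, B n x /\ B n `<=` U.
Hypothesis X_T1 : accessible_space X.

Definition code (k : nat) (x : X) : {ffun 'I_k -> bool} :=
  [ffun i : 'I_k => `[< B i x >]].

Lemma codeP k x y (i : 'I_k) : code k x = code k y -> B i x <-> B i y.
Proof.
move=> /ffunP/(_ i); rewrite !ffunE => h.
by split => /asboolP; [rewrite h|rewrite -h] => /asboolP.
Qed.

(** As soon as [k] exceeds the index of a basic set lying between [x] and [U], sharing the code of
    [x] forces membership in that basic set. *)
Lemma near_code_sub (x : X) (U : set X) : open U -> U x ->
  \forall k \near \oo, [set y | code k y = code k x] `<=` U.
Proof.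
move=> oU Ux; have [n [Bnx BnU]] := Bbasis oU Ux.
exists n.+1 => // k /= nk y /(@codeP _ _ _ (Ordinal nk)) yx.
by apply: BnU; apply/yx.
Qed.

Lemma near_code_neq (x y : X) : x != y ->
  \forall k \near \oo, code k x != code k y.
Proof.
move=> /X_T1[U [oU /set_mem Ux /set_mem Uy]].
apply: filterS (near_code_sub oU Ux) => k kU.
by apply/eqP => /esym/kU.
Qed.

Definition codes (k : nat) (eta : {fset X}) : {set {ffun 'I_k -> bool}} :=
  [set code k (val x) | x : eta]%SET.

Lemma codesP k (eta : {fset X}) c :
  reflect (exists2 x, x \in eta & c = code k x) (c \in codes k eta).
Proof.
apply: (iffP imsetP) => [[x _ ->]|[x xeta ->]]; first by exists (val x) => //; exact: valP.
by exists [` xeta]%fset.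
Qed.

Lemma codesU k (eta1 eta2 : {fset X}) :
  codes k (eta1 `|` eta2)%fset = (codes k eta1 :|: codes k eta2)%SET.
Proof.
apply/setP => c; rewrite inE; apply/codesP/orP => [[x]|].
  by rewrite inE => /orP[] xe ->; [left|right]; apply/codesP; exists x.
by move=> [] /codesP[x xe ->]; exists x => //; rewrite inE xe ?orbT.
Qed.

Definition separates (k : nat) (eta : {fset X}) := {in eta &, injective (code k)}.

Lemma near_separates (eta : {fset X}) : \forall k \near \oo, separates k eta.
Proof.
have : \forall k \near \oo, forall xy : eta * eta,
    val xy.1 != val xy.2 -> code k (val xy.1) != code k (val xy.2).
  apply: filter_forall => -[x y] /=.
  have [->|xy] := eqVneq x y; first by apply: nearW => k; rewrite eqxx.
  by apply: filterS (near_code_neq xy).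
apply: filterS => k sep x y xe ye cxy; apply/eqP; apply: contraT => xy.
by have := sep ([` xe], [` ye])%fset xy; rewrite /= cxy eqxx.
Qed.

Lemma card_codes k eta : separates k eta -> #|codes k eta| = #|` eta|.
Proof.
move=> sep; rewrite cardfE card_imset // => x y /sep/val_inj; apply; exact: valP.
Qed.

(** Quantifying over all [eta] with code set [S] makes this depend on [S] alone, which ranges over a
    finite type. Asking for exactly [#|S|] points restricts to those [eta] that their codes
    separate. *)
Definition approx (U : set {fset X}) (k : nat) (S : {set {ffun 'I_k -> bool}}) :=
  `[< forall eta : {fset X}, #|` eta| = #|S| -> codes k eta = S -> U eta >].

(** Openness is tested on tuples. A set [eta'] with the same codes and cardinality as [eta] can be
    listed so that each point shares the code of the corresponding point of [eta]; for large [k]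
    this tuple is close to the listing of [eta]. *)
Lemma near_codes_sub (U : set {fset X}) (eta : {fset X}) :
  finconf_open U -> U eta ->
  \forall k \near \oo, forall eta' : {fset X},
    #|` eta'| = #|` eta| -> codes k eta' = codes k eta -> U eta'.
Proof.
move=> oU Ueta; have [V oV VU] := oU #|` eta|.
pose t : #|` eta|.-tuple X := in_tuple (enum_fset eta).
have ut : uniq t by rewrite /= fset_uniq.
have tE : fset_of_tuple t = eta by apply/fsetP => x; rewrite !inE.
have Vt : V (fun i => tnth t i) by apply/(VU t ut); rewrite tE.
(* The filter of sets containing, for all large [k], every tuple with coordinatewise the same codes
   as [t]. It converges to [t], hence contains the open set [V]. *)
pose F : set_system (prod_topology (fun _ : 'I_#|` eta| => X)) :=
  [set S | \forall k \near \oo, forall g : 'I_#|` eta| -> X,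
     (forall i, code k (g i) = code k (tnth t i)) -> S g].
have FF : Filter F.
  split.
  - by apply: nearW.
  - by move=> P Q; rewrite /F /=; apply: filterS2 => k Pk Qk g gt; split; [exact: Pk|exact: Qk].
  - by move=> P Q PQ; rewrite /F /=; apply: filterS => k Pk g gt; apply: PQ; exact: Pk.
have Ft : F --> ((fun i => tnth t i) : prod_topology (fun _ : 'I_#|` eta| => X)).
  apply: prod_topology_cvg => i W oW Wt.
  by apply: filterS (near_code_sub oW Wt) => k kW g gt; apply: kW; rewrite /= gt.
have FV : F V by apply: Ft; exact: open_nbhs_nbhs.
have {}FV : \forall k \near \oo, forall g : 'I_#|` eta| -> X,
  (forall i, code k (g i) = code k (tnth t i)) -> V g := FV.
apply: filterS2 FV (near_separates eta) => k kV sep eta' ceta' codesE.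
(* A point of [eta'] is chosen for each code of [eta]. Separation makes the choice injective, and
   equal cardinality makes it exhaust [eta']. *)
have /fin_all_exists2[g geta' gt] : forall i : 'I_#|` eta|,
    exists2 x, x \in eta' & code k x = code k (tnth t i).
  move=> i; have : code k (tnth t i) \in codes k eta'.
    rewrite codesE; apply/codesP; exists (tnth t i) => //.
    by rewrite -[X in _ \in X]tE inE mem_tnth.
  by move=> /codesP[x xe ->]; exists x.
have ginj : injective g.
  move=> i j gij; apply: (tuple_uniqP _ ut).
  by apply: sep; rewrite -?gt ?gij //; rewrite -[X in _ \in X]tE inE mem_tnth.
pose t' := [tuple g i | i < #|` eta|].
have ut' : uniq t' by rewrite map_inj_uniq // enum_uniq.
have <- : fset_of_tuple t' = eta'.
  apply/eqP; rewrite eqEfcard ceta'; apply/andP; split.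
    by apply/fsubsetP => x; rewrite inE => /mapP[i _ ->].
  by rewrite card_fseq undup_id // size_tuple.
apply/(VU t' ut'); have := kV g gt; congr V.
by apply/funext => i; rewrite tnth_mktuple.
Qed.

(** If [U eta] fails, [eta] itself refutes the universal statement in [approx] once its points are
    separated; if it holds, openness gives all sets with the same codes. *)
Lemma near_approx (U : set {fset X}) (eta : {fset X}) : finconf_open U ->
  \forall k \near \oo, approx U (codes k eta) = `[< U eta >].
Proof.
move=> oU; have [Ueta|nUeta] := pselect (U eta).
  apply: filterS2 (near_codes_sub oU Ueta) (near_separates eta) => k kU sep.
  rewrite (asboolT Ueta); apply/asboolP => eta'; rewrite (card_codes sep); exact: kU.
apply: filterS (near_separates eta) => k sep.
rewrite (asboolF nUeta); apply/asboolP => /(_ eta); rewrite (card_codes sep).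
by move=> /(_ erefl erefl).
Qed.

(** Once [k] separates the points of [E], taking codes is a bijection from the subsets of [E] to the
    subsets of [codes k E]. Since [E] has finitely many subsets, one [k] serves them all in
    [near_approx]. *)
Lemma near_count_sub (U : set {fset X}) (E : {fset X}) : finconf_open U ->
  \forall k \near \oo,
    (\sum_(S : {set {ffun 'I_k -> bool}} | S \subset codes k E) approx U S)%N =
    count_sub U E.
Proof.
move=> oU.
have : \forall k \near \oo, forall eta : fpowerset E,
    approx U (codes k (val eta)) = `[< U (val eta) >].
  by apply: filter_forall => eta; exact: near_approx.
apply: filterS2 (near_separates E) => k sep kU.
rewrite /count_sub -[LHS]big_filter.
rewrite (perm_big [seq codes k eta | eta <- fpowerset E]) /=; last first.
  apply: uniq_perm.
  - by rewrite filter_uniq // index_enum_uniq.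
  - rewrite map_inj_in_uniq ?fset_uniq // => eta eta'.
    rewrite !fpowersetE => /fsubsetP sub /fsubsetP sub' codesE.
    apply/fsetP => x; apply/idP/idP => xe.
      have : code k x \in codes k eta by apply/codesP; exists x.
      rewrite codesE => /codesP[y ye] /sep -> //; [exact: sub|exact: sub'].
    have : code k x \in codes k eta' by apply/codesP; exists x.
    rewrite -codesE => /codesP[y ye] /sep -> //; [exact: sub'|exact: sub].
  - move=> S; rewrite mem_filter mem_index_enum andbT.
    apply/idP/mapP => [/fintype.subsetP SE|[eta + ->]].
      exists [fset x in E | code k x \in S]%fset.
        by rewrite fpowersetE; apply/fsubsetP => x; rewrite !inE => /andP[].
      apply/setP => c; apply/idP/codesP => [cS|[x + ->]].
        have /codesP[x xE cx] := SE _ cS; exists x => //.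
        by rewrite !inE /= xE -cx.
      by rewrite !inE => /andP[].
    rewrite fpowersetE => /fsubsetP etaE; apply/fintype.subsetP => c /codesP[x xe ->].
    by apply/codesP; exists x => //; exact: etaE.
rewrite big_map big_seq [RHS]big_seq; apply: eq_bigr => eta etaE.
by rewrite (kU [` etaE]%fset).
Qed.

End basis_codes.

(** * Measurability of unions, traces and subset counts *)

Section measurability_of_configurations.
Context {X : ptopologicalType} {B : nat -> set X}.
Hypothesis Bopen : forall n, open (B n).
Hypothesis Bbasis : forall (x : X) (U : set X), open U -> U x ->
  exists n, B n x /\ B n `<=` U.
Hypothesis X_T1 : accessible_space X.

Definition finconf_count (O : set X) (eta : {fset X}) : nat :=
  #|` [fset x in eta | x \in O]%fset|.

Lemma finconf_countE (O : set X) n (t : n.-tuple X) : uniq t ->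
  finconf_count O (fset_of_tuple t) = #|[set i | tnth t i \in O]%SET|.
Proof.
move=> ut; rewrite /finconf_count.
rewrite (_ : [fset x in _ | _]%fset = [fset x in [seq x <- t | x \in O]]%fset); last first.
  by apply/fsetP => x; rewrite !inE mem_filter andbC.
rewrite card_fseq undup_id ?filter_uniq // size_filter.
rewrite -[X in count _ X = _]map_tnth_enum count_map cardE -size_filter /=.
by rewrite enumT; congr size; apply: eq_filter => i; rewrite /= !inE.
Qed.

(** Coordinates lying in the open set [O] stay there under small perturbations of the tuple, so the
    number of points in [O] is lower semicontinuous. *)
Lemma finconf_open_count (O : set X) j : open O ->
  finconf_open [set eta : {fset X} | (j <= finconf_count O eta)%N].
Proof.
move=> oO n.
exists [set f | (j <= #|[set i | f i \in O]%SET|)%N]; last first.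
  by move=> t ut; rewrite /= finconf_countE.
rewrite openE => f /= jf; rewrite /interior.
have FF : Filter (nbhs f) by exact: nbhs_filter.
have : nbhs f [set g : prod_topology (fun _ : 'I_n => X) |
    forall i, f i \in O -> g i \in O].
  apply: (@filter_forall _ _ (fun i g => f i \in O -> g i \in O) _ FF) => i.
  have [fiO|] := boolP (f i \in O); last by move=> _; exact: nearW.
  have : nbhs f (proj i @^-1` O).
    apply: (@proj_continuous _ (fun _ : 'I_n => X) i f).
    by apply: open_nbhs_nbhs; split => //; exact/set_mem.
  by apply: filterS => g giO _; apply/mem_set.
apply: filterS => g fg /=; apply: leq_trans jf _; apply: subset_leq_card.
by apply/fintype.subsetP => i; rewrite !finset.in_set; exact: fg.
Qed.

Lemma measurable_finconf_open (U : set {fset X}) :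
  finconf_open U -> measurable (U : set (finconf X)).
Proof. exact: sub_sigma_algebra. Qed.

Lemma dmeas_finconf_count (O : set X) : open O ->
  dmeas (finconf_count O : finconf X -> nat).
Proof.
move=> oO; apply: dmeas_nat => j.
by apply: measurable_finconf_open; exact: finconf_open_count.
Qed.

Lemma finconf_countT (eta : {fset X}) : finconf_count setT eta = #|` eta|.
Proof.
by congr (#|` _|)%fset; apply/fsetP => x; rewrite !inE in_setT andbT.
Qed.

Lemma dmeas_card_finconf : dmeas ((fun eta => #|` eta|) : finconf X -> nat).
Proof.
have := dmeas_finconf_count openT; congr dmeas.
by apply/funext => eta; exact: finconf_countT.
Qed.

(** Comparing the counts in two open sets detects whether [eta] meets their difference. This reaches
    the cells of points with a given code, which need not be open. *)
Lemma finconf_count_setI (O O' : set X) (eta : {fset X}) :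
  finconf_count O eta != finconf_count (O `&` O') eta <->
  exists2 x, x \in eta & (O `\` O') x.
Proof.
rewrite /finconf_count; set E' := [fset x in eta | x \in (O `&` O')%classic]%fset.
have sub : (E' `<=` [fset x in eta | x \in O])%fset.
  apply/fsubsetP => x; rewrite !inE => /andP[-> /set_mem[Ox _]] /=.
  exact: mem_set.
split => [neq|[x xe [Ox O'x]]].
  have /fset0Pn : ([fset x in eta | x \in O] `\` E')%fset != fset0.
    rewrite fsetD_eq0; apply: contra neq => sub'.
    by rewrite (_ : [fset x in eta | x \in O]%fset = E') //; apply/eqP; rewrite eqEfsubset sub'.
  move=> [x]; rewrite !inE => /andP[+ /andP[xe xO]].
  rewrite xe /= in_setI xO /= => xO'.
  by exists x => //; split; [exact: set_mem|move=> /mem_set; exact/negP].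
rewrite neq_ltn; apply/orP; right; apply: fproper_ltn_card.
rewrite fproperEneq sub andbT; apply/eqP => /fsetP/(_ x).
rewrite !inE xe /= (mem_set Ox) in_setI => /andP[_ /set_mem].
exact: O'x.
Qed.

(** The points with code [c] are those of [cell_open c] outside [cell_excluded c], a difference of
    two open sets. *)
Definition cell_open k (c : {ffun 'I_k -> bool}) : set X :=
  [set x | forall i, c i -> B i x].

Definition cell_excluded k (c : {ffun 'I_k -> bool}) : set X :=
  [set x | exists2 i : 'I_k, ~~ c i & B i x].

Lemma open_cell_open k (c : {ffun 'I_k -> bool}) : open (cell_open c).
Proof.
rewrite openE => x cx; apply: filter_forall => i.
case: (boolP (c i)) => ci; last exact: nearW.
have : nbhs x (B i) by apply: open_nbhs_nbhs; split => //; exact: cx.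
exact: filterS.
Qed.

Lemma open_cell_excluded k (c : {ffun 'I_k -> bool}) : open (cell_excluded c).
Proof.
rewrite openE => x [i ci Bix].
have : nbhs x (B i) by apply: open_nbhs_nbhs.
by apply: filterS => y Biy; exists i.
Qed.

Lemma cellE k (c : {ffun 'I_k -> bool}) x :
  (cell_open c `\` cell_excluded c) x <-> c = code (B := B) k x.
Proof.
split => [[cx ncx]|->].
  apply/ffunP => i; rewrite ffunE; apply/idP/asboolP => [/cx//|Bix].
  by apply: contrapT => /negP ci; apply: ncx; exists i.
split => [i|[i]]; rewrite ffunE; first by move/asboolP.
by move/asboolP.
Qed.

Lemma dmeas_codes k : dmeas (codes (B := B) k : finconf X -> _).
Proof.
have H (c : {ffun 'I_k -> bool}) : dmeas ((fun eta => finconf_count (cell_open c) eta !=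
    finconf_count (cell_open c `&` cell_excluded c) eta) : finconf X -> bool).
  apply: (dmeas_op (fun a b : nat => a != b)).
    by apply: dmeas_finconf_count; exact: open_cell_open.
  apply: dmeas_finconf_count; apply: openI.
    exact: open_cell_open.
  exact: open_cell_excluded.
have := dmeas_set H; congr dmeas.
apply/funext => eta; apply/setP => c; rewrite inE.
apply/idP/codesP => [/finconf_count_setI[x xe]|[x xe cx]].
  by move/cellE => cx; exists x.
by apply/finconf_count_setI; exists x => //; exact/cellE.
Qed.

(** The indicator of an open set of finite configurations is the eventual value of functions of the
    codes, so measurable codes suffice for a measurable map. *)
Lemma measurable_into_finconf {d} {W : measurableType d} (f : W -> finconf X) :
  (forall k, dmeas (fun w => codes (B := B) k (f w))) -> measurable_fun setT f.
Proof.
move=> mf; apply: (@measurability _ _ W (finconf X) setT f (@finconf_open X)) => // _ [U oU <-]; rewrite setTI.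
have mU : dmeas (fun w => `[< U (f w) >]).
  apply: (@dmeas_lim _ _ _ (fun k w => approx (B := B) U (codes k (f w)))).
    by move=> k; exact: (dmeas_comp (fun S => approx (B := B) U S) (mf k)).
  by move=> w; exact: near_approx.
have := mU [set true]; congr measurable.
by apply/seteqP; split => w /= /asboolP.
Qed.

Lemma measurable_fsetU :
  measurable_fun setT (fun p : finconf X * finconf X => (p.1 `|` p.2)%fset : finconf X).
Proof.
apply: measurable_into_finconf => k.
have := dmeas_op (fun a b => a :|: b)%SET
  (dmeas_measurable_comp (@dmeas_codes k) (@measurable_fst _ _ (finconf X) (finconf X)))
  (dmeas_measurable_comp (@dmeas_codes k) (@measurable_snd _ _ (finconf X) (finconf X))).
by congr dmeas; apply/funext => p /=; rewrite codesU.
Qed.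

Lemma setI_closed_finconf_open : setI_closed (@finconf_open X).
Proof.
move=> U U' oU oU' n; have [V oV UV] := oU n; have [V' oV' UV'] := oU' n.
exists (V `&` V'); first exact: openI.
by move=> t ut; split => -[/(UV _ ut) ? /(UV' _ ut)].
Qed.

(** Dynkin induction on [A]: open sets are stable under intersection and handled by
    [near_count_sub], while the count is additive in [A]. *)
Lemma dmeas_count_sub (A : set (finconf X)) : measurable A ->
  dmeas (count_sub A : finconf X -> nat).
Proof.
move: A; apply: (@dynkin_induction _ (finconf X) (@finconf_open X)
  (fun A => dmeas (count_sub A : finconf X -> nat))) => //.
- exact: setI_closed_finconf_open.
(* For the full set the count is the number of all subsets of [E]. *)
- have := dmeas_comp (fun n => 2 ^ n)%N dmeas_card_finconf; congr dmeas.
  apply/funext => E; rewrite /count_sub /= -card_fpowerset cardfE -sum1_card.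
  by rewrite big_seq_fsetE; apply: eq_bigr => eta _; rewrite asboolT.
- move=> U oU.
  apply: (@dmeas_lim _ (finconf X) _ (fun k E => \sum_(S : {set {ffun 'I_k -> bool}} |
    S \subset codes (B := B) k E) approx (B := B) U S)%N).
    move=> k; exact: (dmeas_comp (fun C => \sum_(S : {set {ffun 'I_k -> bool}} |
      S \subset C) approx (B := B) U S)%N (@dmeas_codes k)).
  by move=> E; exact: near_count_sub.
- move=> A mA IH.
  have := dmeas_op (fun n j => 2 ^ n - j)%N dmeas_card_finconf IH; congr dmeas.
  apply/funext => E; rewrite -card_fpowerset -sum1_size /count_sub -sumnB.
    by apply: eq_bigr => eta _; rewrite asbool_neg; case: asboolP.
  by move=> eta _; case: asboolP.
- move=> F mF tF IH.
  apply: (@dmeas_lim _ (finconf X) _ (fun n E => \sum_(i < n) count_sub (F i) E)%N).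
    by move=> n; exact: dmeas_sum.
  move=> E.
  (* Each of the finitely many subsets of [E] lies in at most one [F i], so the partial sums become
     stationary. *)
  have : \forall n \near \oo, forall eta : fpowerset E,
      (\sum_(i < n) `[< F i (val eta) >])%N = `[< (\bigcup_i F i) (val eta) >].
    apply: filter_forall => eta.
    have [[i _ Fi]|nF] := pselect ((\bigcup_i F i) (val eta)); last first.
      apply: nearW => n; rewrite (asboolF nF) big1 // => i _.
      by rewrite asboolF // => Fi; apply: nF; exists i.
    exists i.+1 => // n /= ni; rewrite (bigD1 (Ordinal ni)) //= asboolT //.
    rewrite big1 ?asboolT //; first by exists i.
    move=> j ji; rewrite asboolF // => Fj.
    move/eqP: ji; apply; apply: val_inj => /=.
    by apply: (tF j i I I); exists (val eta).
  apply: filterS => n nF; rewrite /count_sub exchange_big /= big_seq [RHS]big_seq.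
  by apply: eq_bigr => eta etaE; rewrite (nF [` etaE]%fset).
Qed.

Lemma dmeas_conf_count (L : set X) : bounded_borel L ->
  dmeas (conf_count L : conf X -> nat).
Proof. by move=> bL P; apply: sub_sigma_algebra; exists L, P. Qed.

Lemma bounded_borel_sub (L L' : set X) : bounded_borel L ->
  measurable (L' : set (borel X)) -> L' `<=` L -> bounded_borel L'.
Proof.
move=> [mL cL] mL' L'L; split => //.
apply: (subclosed_compact _ cL); first exact: closed_closure.
exact: closure_subset.
Qed.

Lemma measurable_open_borel (U : set X) : open U -> measurable (U : set (borel X)).
Proof. exact: sub_sigma_algebra. Qed.

Lemma in_conf_proj (L : set X) (g : conf0 X) x : bounded_borel L ->
  (x \in conf_proj L g) = (x \in (g : set X) `&` L).
Proof. by move=> bL; rewrite in_fset_set //; exact: conf_lf. Qed.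

(** The code [c] occurs in the trace on [L] exactly when the configuration has a point in [L]
    intersected with the cell of [c]. That set is bounded Borel, so the count in it is measurable by
    definition. *)
Lemma measurable_conf_proj (L : set X) : bounded_borel L ->
  measurable_fun setT (conf_proj L : conf X -> finconf X).
Proof.
move=> bL; apply: measurable_into_finconf => k.
pose cell (c : {ffun 'I_k -> bool}) := L `&` (cell_open c `\` cell_excluded c).
have bcell c : bounded_borel (cell c).
  apply: (bounded_borel_sub bL) => [|x []//].
  apply: measurableI; first by case: bL.
  apply: measurableD; apply: measurable_open_borel.
    exact: open_cell_open.
  exact: open_cell_excluded.
have := dmeas_set (fun c => dmeas_comp (fun n => 0 < n)%N (dmeas_conf_count (bcell c))).
congr dmeas; apply/funext => g; apply/setP => c; rewrite inE /=.
rewrite /conf_count cardfs_gt0; apply/fset0Pn/codesP => [[x]|[x xg cx]]; last first.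
  exists x; move: xg; rewrite !in_conf_proj // => /set_mem[gx Lx].
  by apply/mem_set; split => //; split => //; exact/cellE.
rewrite in_conf_proj // => /set_mem[gx [Lx /cellE cx]]; exists x => //.
by rewrite in_conf_proj //; exact/mem_set.
Qed.

Lemma conf_projU (L : set X) (g h : conf0 X) : bounded_borel L ->
  conf_proj L (confU g h) = (conf_proj L g `|` conf_proj L h)%fset.
Proof.
by move=> bL; rewrite /conf_proj /= setIUl fset_setU //; exact: conf_lf.
Qed.

Lemma measurable_confU :
  measurable_fun setT (fun p : conf X * conf X => confU p.1 p.2 : conf X).
Proof.
apply: (@measurability _ _ _ (conf X) setT _ (@conf_cylinders X)) => // _ [_ [L [P [bL ->]] <-]]; rewrite setTI.
have m1 : measurable_fun setT (fun p : conf X * conf X => conf_proj L p.1 : finconf X).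
  exact: measurableT_comp (measurable_conf_proj bL) measurable_fst.
have m2 : measurable_fun setT (fun p : conf X * conf X => conf_proj L p.2 : finconf X).
  exact: measurableT_comp (measurable_conf_proj bL) measurable_snd.
have := dmeas_measurable_comp dmeas_card_finconf
  (measurableT_comp measurable_fsetU (measurable_fun_pair m1 m2)).
move=> /(_ P); congr measurable.
by apply/seteqP; split => -[g h] /=; rewrite /preimage /= /conf_count conf_projU.
Qed.

End measurability_of_configurations.

(** * The K-transform as a finite sum for functions living on a bounded set *)

Section K_transform_finite.
Context {R : realType} {X : ptopologicalType}.
Local Open Scope ereal_scope.

Lemma K_transformE (L : set X) (G : finconf X -> \bar R) (g : conf X) :
  bounded_borel L -> (forall eta, 0 <= G eta) ->
  (forall eta, ~ finconf_in L eta -> G eta = 0) ->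
  K_transform G g = \sum_(eta <- fpowerset (conf_proj L g)) G eta.
Proof.
move=> bL G0 GL; rewrite /K_transform.
have -> : \sum_(eta <- fpowerset (conf_proj L g)) G eta =
    \esum_(eta in [set` fpowerset (conf_proj L g)]) G eta.
  by rewrite esum_fset ?fsbig_finite ?set_fsetK.
rewrite esum_mkcond [RHS]esum_mkcond; apply: eq_esum => eta _.
have [etaL|/GL ->] := pselect (finconf_in L eta); last by rewrite !if_same.
congr (if _ then _ else _); apply/idP/idP => /set_mem.
  move=> etag; apply/mem_set => /=; rewrite fpowersetE; apply/fsubsetP => x xe.
  by rewrite in_conf_proj //; apply/mem_set; split; [exact: etag|exact: etaL].
rewrite /= fpowersetE => /fsubsetP etag; apply/mem_set => x /etag.
by rewrite in_conf_proj // => /set_mem[].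
Qed.

Lemma K_transform_indic (L : set X) (A : set (finconf X)) (g : conf X) :
  bounded_borel L -> (forall eta, A eta -> finconf_in L eta) ->
  K_transform (fun eta => (\1_A eta)%:E) g = (count_sub A (conf_proj L g))%:R%:E :> \bar R.
Proof.
move=> bL AL; rewrite (K_transformE _ bL) //.
- rewrite /count_sub natr_sum -sumEFin; apply: eq_bigr => eta _.
  by rewrite indicE; congr (_%:R%:E); congr nat_of_bool.
- by move=> eta etaL; rewrite indicE memNset // => /AL.
Qed.

End K_transform_finite.

Lemma leq_expn (m n N : nat) : (m <= n)%N -> (m ^ N <= n ^ N)%N.
Proof. by case: N => // N; rewrite leq_exp2r. Qed.

(** * Campbell's formula and moment bounds *)

Section correlation_measure.
Context {R : realType} {X : ptopologicalType} {B : nat -> set X}.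
Hypothesis Bopen : forall n, open (B n).
Hypothesis Bbasis : forall (x : X) (U : set X), open U -> U x ->
  exists n, B n x /\ B n `<=` U.
Hypothesis X_T1 : accessible_space X.
Local Open Scope ereal_scope.

Definition finconf_le (L : set X) (N : nat) : set (finconf X) :=
  [set eta : {fset X} | finconf_in L eta /\ (#|` eta| <= N)%N].

Lemma bounded_borel_closure (L : set X) : bounded_borel L -> bounded_borel (closure L).
Proof.
move=> [mL cL]; split.
  rewrite -[X in measurable X]setCK; apply: measurableC.
  by apply: measurable_open_borel; apply: closed_openC; exact: closed_closure.
by rewrite -(closure_id _).1 //; exact: closed_closure.
Qed.

(** For closed [L], lying in [L] means having no point in the open complement, and counts in open
    sets are measurable. *)
Lemma measurable_finconf_le (L : set X) (N : nat) : closed L ->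
  measurable (finconf_le L N).
Proof.
move=> cL; have oL : open (~` L) by exact: closed_openC.
have := dmeas_op (fun a b => (a == 0) && (b <= N))%N
  (dmeas_finconf_count oL) (@dmeas_card_finconf X).
move=> /(_ [set true]); congr measurable; apply/seteqP; split => eta /=.
  move=> /andP[/eqP/cardfs0_eq e0 eN]; split => // x xe.
  apply: contrapT => Lx; have := in_fset0 x; rewrite -e0 !inE.
  by rewrite [x \in eta]xe => /negP; apply; apply/mem_set.
move=> [etaL eN]; rewrite /preimage /= eN andbT cardfs_eq0; apply/eqP/fsetP => x; rewrite !inE.
by apply/negP => /andP[/etaL Lx /set_mem].
Qed.

Lemma measurable_natr_dmeas d (W : measurableType d) (f : W -> nat) :
  dmeas f -> measurable_fun setT (fun w => (f w)%:R : R).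
Proof. by move=> mf; apply: dmeas_measurable_fun; exact: (dmeas_comp (fun n => n%:R)). Qed.

Lemma measurable_natr_conf_proj (L : set X) (f : {fset X} -> nat) : bounded_borel L ->
  dmeas (f : finconf X -> nat) ->
  measurable_fun setT (fun g : conf X => ((f (conf_proj L g))%:R : R)%:E).
Proof.
move=> bL mf; apply/measurable_EFinP/measurable_natr_dmeas.
exact: (dmeas_measurable_comp mf (measurable_conf_proj Bopen Bbasis X_T1 bL)).
Qed.

Section campbell.
Variables (mu : probability (conf X) R) (rho : {measure set (finconf X) -> \bar R}).
Hypothesis mu_rho : is_correlation_measure mu rho.
Variables (L : set X) (N : nat).
Hypothesis bL : bounded_borel L.

Lemma correlation_measureE (A : set (finconf X)) : measurable A ->
  A `<=` finconf_le L N ->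
  rho A = \int[mu]_g (count_sub A (conf_proj L g))%:R%:E.
Proof.
move=> mA AL; rewrite mu_rho.2; last by split => //; exists L, N.
by apply: eq_integral => g _; apply: K_transform_indic => // eta /AL[].
Qed.

Import HBNNSimple.

Let K_nnsfun (h : {nnsfun finconf X >-> R}) (g : conf X) : \bar R :=
  \sum_(eta <- fpowerset (conf_proj L g)) (h eta)%:E.

Let K_nnsfunE h g : K_nnsfun h g = \sum_(v <- fset_set (range h))
  (v%:E * (count_sub (h @^-1` [set v]) (conf_proj L g))%:R%:E).
Proof.
rewrite /K_nnsfun; under [RHS]eq_bigr do rewrite -EFinM.
rewrite !sumEFin; congr EFin.
under [RHS]eq_bigr do rewrite natr_sum mulr_sumr.
rewrite exchange_big /=; apply: eq_bigr => eta _.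
by rewrite [LHS]fimfunE fsbig_finite.
Qed.

Let measurable_term (h : {nnsfun finconf X >-> R}) (v : R) :
  measurable_fun setT (fun g : conf X => ((count_sub (h @^-1` [set v]) (conf_proj L g))%:R : R)%:E).
Proof.
apply: measurable_natr_conf_proj => //.
exact: (dmeas_count_sub Bopen Bbasis X_T1).
Qed.

(** A negative [v] is not a value of [h]: its level set is empty and the term vanishes. *)
Let term_ge0 (h : {nnsfun finconf X >-> R}) (v : R) (g : conf X) :
  0 <= v%:E * (count_sub (h @^-1` [set v]) (conf_proj L g))%:R%:E :> \bar R.
Proof.
have [v0|v0] := leP 0%R v; first by rewrite -EFinM lee_fin mulr_ge0.
rewrite preimage_nnfun0 // count_sub_set0 mule0 //.
Qed.

Let measurable_K_nnsfun h : measurable_fun setT (K_nnsfun h).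
Proof.
rewrite (funext (K_nnsfunE h)).
by apply: emeasurable_sum => v; exact: measurable_funeM.
Qed.

Let campbell_nnsfun (h : {nnsfun finconf X >-> R}) :
  (forall eta, h eta != 0%R -> finconf_le L N eta) ->
  \int[rho]_eta (h eta)%:E = \int[mu]_g K_nnsfun h g.
Proof.
move=> hL; rewrite integralT_nnsfun sintegralE fsbig_finite //=.
under eq_integral do rewrite K_nnsfunE.
rewrite ge0_integral_sum //; last first.
  by move=> v; exact: measurable_funeM.
apply: eq_bigr => v _; have [->|v0] := eqVneq v 0%R.
  by rewrite mul0e; under eq_integral do rewrite mul0e; rewrite integral0.
have [vp|vn] := leP 0%R v; last first.
  rewrite preimage_nnfun0 // measure0 mule0.
  by under eq_integral do rewrite count_sub_set0 mule0; rewrite integral0.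
rewrite ge0_integralZl_EFin //.
rewrite correlation_measureE //.
by move=> eta /= hv; apply: hL; rewrite hv.
Qed.

(** The formula holds for indicators by definition of the correlation measure, for simple functions
    by linearity, and in general by monotone convergence under both integrals. *)
Lemma campbell (h : finconf X -> \bar R) : measurable_fun setT h ->
  (forall eta, 0 <= h eta) -> (forall eta, h eta != 0 -> finconf_le L N eta) ->
  \int[rho]_eta h eta =
  \int[mu]_g \sum_(eta <- fpowerset (conf_proj L g)) h eta.
Proof.
move=> mh h0 hL; pose h_ := nnsfun_approx measurableT mh.
have h_h eta : (h_ n eta)%:E @[n --> \oo] --> h eta.
  by apply: cvg_nnsfun_approx => // ? _; exact: h0.
have nd_h eta : nondecreasing_seq (fun n => (h_ n eta)%:E).
  by move=> m n mn; rewrite lee_fin; exact/lefP/nd_nnsfun_approx.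
(* The approximants lie below [h] and thus inherit its bounded support. *)
have h_L n eta : h_ n eta != 0%R -> finconf_le L N eta.
  move=> hn0; apply: hL; apply: contra hn0 => /eqP heta0.
  have : (h_ n eta)%:E <= h eta.
    rewrite -(cvg_lim _ (h_h eta)) //.
    rewrite (cvg_lim _ (ereal_nondecreasing_cvgn (nd_h eta))) //.
    by apply: ereal_sup_ubound; exists n.
  by rewrite heta0 lee_fin => hle; rewrite eq_le hle fun_ge0.
have -> : h = fun eta => limn (fun n => (h_ n eta)%:E).
  by apply/funext => eta; exact/esym/cvg_lim.
rewrite monotone_convergence //; last 2 first.
- by move=> n; exact/measurable_EFinP.
- by move=> n eta _; rewrite lee_fin fun_ge0.
rewrite (funext (fun n => campbell_nnsfun (h_L n))).
rewrite -(@monotone_convergence _ _ _ mu setT measurableT (fun n => K_nnsfun (h_ n))) //.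
- apply: eq_integral => g _; rewrite /K_nnsfun lim_nnesum //.
    by move=> eta _; apply: nearW => n; rewrite lee_fin fun_ge0.
  by move=> eta _; apply/cvg_ex; exists (h eta).
- by move=> n g _; apply: sume_ge0 => eta _; rewrite lee_fin fun_ge0.
- by move=> g _ m n mn; apply: lee_sum => eta _; exact: nd_h.
Qed.

End campbell.

Lemma moment_lty (mu : probability (conf X) R) (L : set X) (N : nat) :
  finite_moments mu -> bounded_borel L ->
  \int[mu]_g ((conf_count L g).+1 ^ N)%:R%:E < +oo.
Proof.
move=> fm bL.
have mc (f : nat -> nat) : measurable_fun setT
    (fun g : conf X => ((f (conf_count L g))%:R : R)%:E).
  by apply/measurable_EFinP/measurable_natr_dmeas; exact: (dmeas_comp f (dmeas_conf_count bL)).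
(* For [n >= 1] one has [n + 1 <= 2 n]; the summand 1 covers [n = 0]. *)
apply: (@le_lt_trans _ _ (\int[mu]_g ((2 ^ N)%:R%:E * ((conf_count L g ^ N)%:R%:E + 1)))).
  apply: ge0_le_integral => //.
  - exact: (mc (fun n => n.+1 ^ N)%N).
  - apply: measurable_funeM; apply: emeasurable_funD => //.
    exact: (mc (fun n => n ^ N)%N).
  - move=> g _; rewrite -EFinD -EFinM lee_fin natr1 -natrM ler_nat.
    case: (conf_count L g) => [|n].
      by rewrite exp1n muln_gt0 expn_gt0.
    apply: (@leq_trans ((2 * n.+1) ^ N)); last by rewrite expnMn leq_mul2l leqnSn orbT.
    by apply: leq_expn; lia.
rewrite ge0_integralZl_EFin //; last 2 first.
- by move=> g _; rewrite adde_ge0.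
- by apply: emeasurable_funD => //; exact: (mc (fun n => n ^ N)%N).
rewrite ge0_integralD //; last exact: (mc (fun n => n ^ N)%N).
rewrite integral_cst // mul1e [X in _ * (_ + X)](_ : _ = 1); last exact: probability_setT.
apply: lte_mul_pinfty => //; apply: lte_add_pinfty; [exact: fm|by rewrite ltry].
Qed.

(** * Integrals against a convolution of functions with polynomial growth *)

Section convolution.
Variables (mu1 mu2 : probability (conf X) R).
Hypotheses (fm1 : finite_moments mu1) (fm2 : finite_moments mu2).
Variables (L : set X) (N : nat) (F : conf X -> nat).
Hypothesis bL : bounded_borel L.
Hypothesis mF : dmeas F.
Hypothesis F_le : forall g, (F g <= (conf_count L g).+1 ^ N)%N.

Lemma measurable_conf_convolution :
  measurable_fun setT (fun p : conf X * conf X => ((F (confU p.1 p.2))%:R : R)%:E).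
Proof.
apply/measurable_EFinP/measurable_natr_dmeas.
exact: (dmeas_measurable_comp mF (measurable_confU Bopen Bbasis X_T1)).
Qed.

(** One plus the size of a union is at most the product of one plus each size, so the double
    integral is bounded by a product of two moments. *)
Lemma conf_convolution_lty :
  \int[mu2]_g2 \int[mu1]_g1 (F (confU g1 g2))%:R%:E < +oo.
Proof.
have mc : measurable_fun setT (fun g : conf X => (((conf_count L g).+1 ^ N)%:R : R)%:E).
  apply/measurable_EFinP/measurable_natr_dmeas.
  exact: (dmeas_comp (fun n => n.+1 ^ N)%N (dmeas_conf_count bL)).
have mFU := measurable_conf_convolution.
apply: (@le_lt_trans _ _ (\int[mu2]_g2 (((conf_count L g2).+1 ^ N)%:R%:E *
    \int[mu1]_g1 ((conf_count L g1).+1 ^ N)%:R%:E))).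
  apply: ge0_le_integral => //.
  - by move=> g2 _; apply: integral_ge0.
  - by apply: (measurable_fun_fubini_tonelli_G _ mFU) => p; rewrite lee_fin.
  - by under eq_fun do rewrite muleC; exact: measurable_funeM.
  - move=> g2 _; rewrite -ge0_integralZl_EFin //.
    apply: ge0_le_integral => //.
    + exact: (measurable_fun_pair1 g2 mFU).
    + exact: measurable_funeM.
    + move=> g1 _; rewrite -EFinM lee_fin -natrM ler_nat -expnMn.
      apply: leq_trans (F_le _) _; apply: leq_expn.
      rewrite /conf_count conf_projU //.
      have := cardfsU (conf_proj L g1) (conf_proj L g2); nia.
under eq_integral do rewrite muleC.
rewrite ge0_integralZl //; last by apply: integral_ge0.
apply: lte_mul_pinfty.
- by apply: integral_ge0.
- by rewrite ge0_fin_numE ?integral_ge0 //; exact: moment_lty.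
- exact: moment_lty.
Qed.

Lemma integral_conf_convolution (mu : probability (conf X) R) :
  is_conf_convolution mu1 mu2 mu ->
  \int[mu]_g (F g)%:R%:E = \int[mu2]_g2 \int[mu1]_g1 (F (confU g1 g2))%:R%:E.
Proof.
move=> hmu; apply: (hmu (fun g => (F g)%:R)); first exact: measurable_natr_dmeas.
apply/integrable21ltyP; first exact: measurable_conf_convolution.
under eq_integral do under eq_integral do rewrite gee0_abs //.
exact: conf_convolution_lty.
Qed.

End convolution.

End correlation_measure.

(** * Fixed points are almost surely not occupied *)

Section point_null.
Context {R : realType} {X : ptopologicalType}.
Variable m : {measure set (borel X) -> \bar R}.
Hypothesis m_non_atomic : non_atomic m.
Hypothesis X_T1 : accessible_space X.
Local Open Scope ereal_scope.

Lemma power_measure_set0 n : power_measure m (set0 : set (n.-tuple (borel X))) = 0.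
Proof.
elim: n => [|n ih] /=; first by rewrite measure0.
under eq_integral => x _ do rewrite (_ : [set t | _] = set0) ?ih //.
by rewrite integral0.
Qed.

Lemma measurable_borel_set1 (x : X) : measurable ([set x] : set (borel X)).
Proof.
rewrite -[X in measurable X]setCK; apply: measurableC; apply: measurable_open_borel.
by apply: closed_openC; exact: accessible_closed_set1.
Qed.

Lemma bounded_borel_set1 (x : X) : bounded_borel [set x].
Proof.
split; first exact: measurable_borel_set1.
rewrite -(closure_id _).1; first exact: compact_set1.
exact: accessible_closed_set1.
Qed.

(** Only the one-point term can charge [A], and there it is the [m]-measure of a subset of
    [[set x]], null by non-atomicity. *)
Lemma lebesgue_poisson_point (z : R) (x : X) (A : set (finconf X)) :
  (forall eta : {fset X}, A eta -> eta = [fset x]%fset) ->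
  lebesgue_poisson m z A = 0.
Proof.
move=> Ax; rewrite /lebesgue_poisson eseries0 // => n _ _.
suff -> : finconf_measure m n A = 0 by rewrite mule0.
rewrite /finconf_measure.
have uniqx (t : n.-tuple X) : uniq t -> A (fset_of_tuple t) -> n = 1%N /\ x \in (t : seq X).
  move=> ut At; have tx := Ax _ At; split.
    have := congr1 (fun E : {fset X} => #|` E|) tx.
    by rewrite card_fseq undup_id // size_tuple cardfs1.
  have : x \in fset_of_tuple t by rewrite tx inE.
  by rewrite inE.
have [n1|n1] := eqVneq n 1%N; last first.
  rewrite (_ : [set t | _] = set0) ?power_measure_set0 //.
  by apply/seteqP; split => // t [ut /(uniqx _ ut)[n1' _]]; rewrite n1' eqxx in n1.
move: uniqx; rewrite {}n1 => uniqx /=.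
pose S : set (borel X) := [set y | A (fset_of_tuple [tuple y])].
have Sx : S `<=` [set x].
  by move=> y /(uniqx [tuple y] isT)[_]; rewrite inE => /eqP.
have mS : measurable S.
  by have [->|->] := subset_set1 Sx; [exact: measurable0|exact: measurable_borel_set1].
transitivity (\int[m]_y (\1_S y)%:E); last first.
  rewrite integral_indic // setIT; apply/eqP; rewrite eq_le measure_ge0 andbT.
  by rewrite -(m_non_atomic x) le_measure // inE //; exact: measurable_borel_set1.
apply: eq_integral => y _; rewrite diracE indicE; congr (_%:R%:E).
congr nat_of_bool; apply/idP/idP => /set_mem Ay; apply/mem_set.
  case: Ay => _; rewrite /S /=; congr (A (fset_of_tuple _)); exact: val_inj.
split => //; move: Ay; rewrite /S /=; congr (A (fset_of_tuple _)); exact: val_inj.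
Qed.

Lemma measurable_finconf_mem (x : X) : measurable ([set eta : finconf X | x \in (eta : {fset X})]).
Proof.
have oT : open [set: X] by exact: openT.
have oC : open (~` [set x]) by apply: closed_openC; exact: accessible_closed_set1.
have := dmeas_op (fun a b => a != b)%N (dmeas_finconf_count oT)
  (dmeas_finconf_count (openI oT oC)).
move=> /(_ [set true]); congr measurable; apply/seteqP; split => eta /=.
  by move=> /finconf_count_setI[y ye [_ /contrapT /= <-]].
by move=> xe; apply/finconf_count_setI; exists x => //; split => // /(_ erefl).
Qed.

(** Local absolute continuity is applied on the bounded set [[set x]], where the only configuration
    containing [x] is the singleton. *)
Lemma conf_point_null (mu : probability (conf X) R) (x : X) :
  locally_abs_continuous m mu -> {ae mu, forall g : conf X, ~ conf_set g x}.
Proof.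
move=> [z z0 /(_ _ (bounded_borel_set1 x)) ac].
have memE : conf_proj [set x] @^-1` [set eta : {fset X} | x \in eta] =
    [set g : conf X | conf_set g x].
  apply/seteqP; split => g; rewrite /preimage /= in_conf_proj //; do ?exact: bounded_borel_set1.
    by move=> /set_mem[].
  by move=> gx; apply/mem_set.
have mx := measurable_finconf_mem x.
exists [set g : conf X | conf_set g x]; split.
- have := dmeas_conf_count (bounded_borel_set1 x) [set n | (0 < n)%N].
  congr measurable; rewrite -memE; apply/seteqP; split => g; rewrite /preimage /= cardfs_gt0.
    move=> /fset0Pn[y yg]; move: (yg); rewrite in_conf_proj; last exact: bounded_borel_set1.
    by move=> /set_mem[_ /= yx]; rewrite yx in yg.
  by move=> xg; apply/fset0Pn; exists x.
- rewrite -memE; apply: (ac [set eta : finconf X | x \in (eta : {fset X})]) => // A mA Ax.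
  rewrite /poisson_in (@lebesgue_poisson_point z x) ?mule0 // => eta [/Ax /= xe ex].
  apply/fsetP => y; rewrite inE; apply/idP/eqP => [/ex//|->//].
- by move=> g /= /contrapT.
Qed.

End point_null.

(** * The convolution identity on bounded sets *)

Section convolution_of_correlation_measures.
Context {R : realType} {X : ptopologicalType} {B : nat -> set X}.
Hypothesis Bopen : forall n, open (B n).
Hypothesis Bbasis : forall (x : X) (U : set X), open U -> U x ->
  exists n, B n x /\ B n `<=` U.
Hypothesis X_T1 : accessible_space X.
Variable m : {measure set (borel X) -> \bar R}.
Hypothesis m_non_atomic : non_atomic m.
Variables mu1 mu2 mu : probability (conf X) R.
Hypotheses (mu1_fm : M1_fm_pi m mu1) (mu2_fm : finite_moments mu2).
Hypothesis muE : is_conf_convolution mu1 mu2 mu.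
Variables rho1 rho2 rho : {measure set (finconf X) -> \bar R}.
Hypothesis rho1E : is_correlation_measure mu1 rho1.
Hypothesis rho2E : is_correlation_measure mu2 rho2.
Hypothesis rhoE : is_finconf_convolution rho1 rho2 rho.
Local Open Scope ereal_scope.

(** A finite union of null sets, one for each point of [E]. *)
Lemma ae_disjoint_conf_proj (L : set X) (E : {fset X}) : bounded_borel L ->
  {ae mu1, forall g : conf X, [disjoint conf_proj L g & E]%fset}.
Proof.
move=> bL.
have : \forall g \near almost_everywhere mu1, forall x : E, ~ conf_set (g : conf X) (val x).
  apply: filter_forall => x; exact: (conf_point_null m_non_atomic X_T1 (val x) mu1_fm.2).
apply: filterS => g gE; apply/fdisjointP => x.
rewrite in_conf_proj // => /set_mem[gx _]; apply/negP => xE.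
exact: (gE [` xE]%fset).
Qed.

Lemma finite_moments_conf_convolution : finite_moments mu.
Proof.
move=> L n bL.
have mF : dmeas ((fun g => conf_count L g ^ n)%N : conf X -> nat).
  exact: (dmeas_comp (fun k => k ^ n)%N (dmeas_conf_count bL)).
have F_le (g : conf X) : (conf_count L g ^ n <= (conf_count L g).+1 ^ n)%N.
  exact: leq_expn.
rewrite (integral_conf_convolution Bopen Bbasis X_T1 mu1_fm.1 mu2_fm bL mF F_le muE).
exact: (conf_convolution_lty Bopen Bbasis X_T1 mu1_fm.1 mu2_fm bL mF F_le).
Qed.

Section bounded_set.
Variables (L : set X) (N : nat) (A : set (finconf X)).
Hypothesis bL : bounded_borel L.
Hypothesis cL : closed L.
Hypothesis mA : measurable A.
Hypothesis AL : A `<=` finconf_le L N.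

Let shift (eta2 : finconf X) : set (finconf X) :=
  [set eta1 : {fset X} | A (eta1 `|` eta2)%fset].

Let measurable_union :
  measurable [set p : finconf X * finconf X | A (p.1 `|` p.2)%fset].
Proof.
have mU := measurable_fsetU Bopen Bbasis X_T1.
by have := mU measurableT _ mA; rewrite setTI.
Qed.

Let ysection_union eta2 :
  ysection [set p : finconf X * finconf X | A (p.1 `|` p.2)%fset] eta2 = shift eta2.
Proof. by apply/seteqP; split => eta1; rewrite /ysection /= inE. Qed.

Let measurable_shift eta2 : measurable (shift eta2).
Proof. by rewrite -ysection_union; exact: measurable_ysection. Qed.

Let shift_le eta2 : shift eta2 `<=` finconf_le L N.
Proof.
move=> eta1 /AL[sub card]; split.
  by move=> x xe; apply: sub; rewrite /= inE [x \in _]xe.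
by apply: leq_trans card; apply: fsubset_leq_card; exact: fsubsetUl.
Qed.

(** If some union with [eta2] lies in [A], then [eta2] obeys the bounds of [A]. This supplies the
    support condition for [campbell] applied to [rho2]. *)
Let shift_neq0 eta2 : rho1 (shift eta2) != 0 -> finconf_le L N eta2.
Proof.
have [->|/set0P[eta1 /AL[sub card]] _] := eqVneq (shift eta2) set0.
  by rewrite measure0 eqxx.
split; first by move=> x xe; apply: sub; rewrite /= inE [X in _ || X]xe orbT.
by apply: leq_trans card; apply: fsubset_leq_card; exact: fsubsetUr.
Qed.

Let rho1_finconf_le : rho1 (finconf_le L N) < +oo.
Proof.
have mle := measurable_finconf_le N cL.
rewrite (correlation_measureE rho1E bL mle (@subset_refl _ _)).
apply: le_lt_trans (moment_lty N mu1_fm.1 bL).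
apply: ge0_le_integral => //.
- apply: measurable_natr_conf_proj => //; exact: dmeas_count_sub.
- apply/measurable_EFinP/measurable_natr_dmeas.
  exact: (dmeas_comp (fun n => n.+1 ^ N)%N (dmeas_conf_count bL)).
- by move=> g _; rewrite lee_fin ler_nat; apply: leq_count_sub => eta [].
Qed.

(** The sections all lie in [finconf_le L N], so [rho1] may be replaced by its restriction to that
    set, a finite measure to which measurability of section measures applies. *)
Let measurable_rho1_shift : measurable_fun setT (fun eta2 => rho1 (shift eta2)).
Proof.
have mle := measurable_finconf_le N cL.
have := measurable_fun_ysection (mfrestr mle rho1_finconf_le) measurable_union.
congr measurable_fun; apply/funext => eta2 /=.
rewrite ysection_union /mfrestr /mrestr; congr (rho1 _).
by rewrite setIidl //; exact: shift_le.
Qed.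

Let indic_union eta2 :
  \int[rho1]_eta1 (\1_A (eta1 `|` eta2)%fset : R)%:E = rho1 (shift eta2).
Proof. by rewrite -[shift eta2]setIT -integral_indic. Qed.

Lemma integral_convolution_union :
  \int[rho2]_eta2 \int[rho1]_eta1 (\1_A (eta1 `|` eta2)%fset : R)%:E =
  \int[mu2]_g2 \int[mu1]_g1 (count_sub A (conf_proj L (confU g1 g2)))%:R%:E.
Proof.
under eq_integral do rewrite indic_union.
(* Campbell's formula for [rho2] is applied to the function sending [eta2] to [rho1 (shift eta2)];
   each of these values is then a [mu1]-integral. *)
rewrite (campbell Bopen Bbasis X_T1 rho2E bL measurable_rho1_shift _ shift_neq0) //.
apply: eq_integral => g2 _.
under eq_bigr => eta2 _ do
  rewrite (correlation_measureE rho1E bL (measurable_shift eta2) (@shift_le eta2)).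
have mterm eta2 : measurable_fun setT
    (fun g1 : conf X => (count_sub (shift eta2) (conf_proj L g1))%:R%:E : \bar R).
  by apply: measurable_natr_conf_proj => //; exact: dmeas_count_sub.
rewrite -ge0_integral_sum //.
apply: ge0_ae_eq_integral => //.
- exact: emeasurable_sum.
- have mF : dmeas ((fun g => count_sub A (conf_proj L g)) : conf X -> nat).
    exact: (dmeas_measurable_comp (dmeas_count_sub Bopen Bbasis X_T1 mA)
      (measurable_conf_proj Bopen Bbasis X_T1 bL)).
  exact: (measurable_fun_pair1 g2 (measurable_conf_convolution Bopen Bbasis X_T1 mF)).
- by move=> g1 _; apply: sume_ge0.
(* With [g2] fixed, its trace on [L] is a finite set, avoided by [mu1]-almost every [g1]; there
   [count_subU] applies. *)
- apply: filterS (ae_disjoint_conf_proj (conf_proj L g2) bL) => g1 dis _ /=.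
  by rewrite conf_projU // count_subU // sumEFin natr_sum.
Qed.

Lemma correlation_measure_convolution_in :
  rho A = \int[mu]_g (count_sub A (conf_proj L g))%:R%:E.
Proof.
have mF : dmeas ((fun g => count_sub A (conf_proj L g)) : conf X -> nat).
  exact: (dmeas_measurable_comp (dmeas_count_sub Bopen Bbasis X_T1 mA)
    (measurable_conf_proj Bopen Bbasis X_T1 bL)).
have F_le (g : conf X) : (count_sub A (conf_proj L g) <= (conf_count L g).+1 ^ N)%N.
  by apply: leq_count_sub => eta /AL[].
rewrite (integral_conf_convolution Bopen Bbasis X_T1 mu1_fm.1 mu2_fm bL mF F_le muE).
rewrite -integral_convolution_union -[in LHS](setIT A) -integral_indic //.
apply: (rhoE (G := \1_A)) => //.
(* The finiteness required by the convolution of [rho1] and [rho2] comes from the same identity,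
   whose right-hand side is bounded by moments. *)
under eq_integral do under eq_integral do rewrite ger0_norm //.
rewrite integral_convolution_union.
exact: (conf_convolution_lty Bopen Bbasis X_T1 mu1_fm.1 mu2_fm bL mF F_le).
Qed.

End bounded_set.

Lemma correlation_measure_convolution : is_correlation_measure mu rho.
Proof.
split; first exact: finite_moments_conf_convolution.
move=> A [mA [L [N [bL AL]]]].
(* Passing to the closure keeps [L] bounded and provides the closedness behind
   [measurable_finconf_le]. *)
have bcL := bounded_borel_closure bL.
have AcL : A `<=` finconf_le (closure L) N.
  by move=> eta /AL[sub card]; split => // x /sub; exact: subset_closure.
rewrite (correlation_measure_convolution_in bcL (@closed_closure _ L) mA AcL).
by apply: eq_integral => g _; apply/esym/K_transform_indic => // eta /AcL[].
Qed.

End convolution_of_correlation_measures.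

(** * Enumerating a countable base, and the theorem *)

Lemma second_countable_basis (X : topologicalType) : @second_countable X ->
  exists B : nat -> set X, (forall n, open (B n)) /\
    forall (x : X) (U : set X), open U -> U x -> exists n, B n x /\ B n `<=` U.
Proof.
move=> [S cS [Sopen Sbasis]].
have /countable_injP[g ginj] := cS.
(* By injectivity of [g] the union has at most one member; it is empty when [n] is not an index. *)
exists (fun n => \bigcup_(U in [set U | S U /\ g U = n]) U); split.
  by move=> n; apply: bigcup_open => U [/Sopen].
move=> x U oU Ux; have [V [SV Vx] VU] := Sbasis x U (open_nbhs_nbhs (conj oU Ux)).
exists (g V); split; first by exists V.
move=> y [W [SW gWV] Wy]; apply: VU.
by rewrite -(ginj _ _ _ _ gWV) //; exact/mem_set.
Qed.

Theorem proposition5p3 (R : realType) (d : nat) (X : ptopologicalType)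
    (M : oriented_riemannian_manifold R d X)
    (Xconnected : connected [set: X])
    (Xnoncompact : ~ compact [set: X])
    (m : {measure set (borel X) -> \bar R})
    (mradon : radon m) (mnonatomic : non_atomic m)
    (Xexhausted : exists L : nat -> set X,
      [/\ forall n, bounded_borel (L n),
          forall n, L n `<=` L n.+1 &
          \bigcup_n L n = [set: X]])
    (mu1 mu2 : probability (conf X) R)
    (hmu1 : M1_fm_pi m mu1) (hmu2 : M1_fm_pi m mu2)
    (rho1 rho2 : {measure set (finconf X) -> \bar R})
    (hrho1 : is_correlation_measure mu1 rho1)
    (hrho2 : is_correlation_measure mu2 rho2)
    (mu : probability (conf X) R)
    (hmu : is_conf_convolution mu1 mu2 mu)
    (rho : {measure set (finconf X) -> \bar R})
    (hrho : is_finconf_convolution rho1 rho2 rho) :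
  is_correlation_measure mu rho.
Proof.
have X_T1 : accessible_space X by exact: hausdorff_accessible (mfd_hausdorff M).
have [B [Bopen Bbasis]] := second_countable_basis (mfd_second_countable M).
exact: (correlation_measure_convolution Bopen Bbasis X_T1 mnonatomic hmu1 hmu2.1
  hmu hrho1 hrho2 hrho).
Qed.
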